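(* Let $\mathbf{A}=\mathbf{H}+\mathbf{Z}$ on $[a,b]$ and $\mathbf{F}$ be as in the context. (i) (Homogeneous case.) Let $(\mathbf{y}_j)_{j\ge 0}$ be a sequence of vector functions on $[a,b]$ satisfying $$\mathbf{y}_0'=\mathbf{H}(x)\mathbf{y}_0,\qquad \mathbf{y}_j'=\mathbf{H}(x)\mathbf{y}_j+\mathbf{Z}(x)\mathbf{y}_{j-1}\quad (j=1,2,3,\ldots).$$ If the series $\sum_{j=0}^{\infty}\mathbf{y}_j(x)$ converges on $[a,b]$, then its sum $\mathbf{S}(x)=\sum_{j=0}^{\infty}\mathbf{y}_j(x)$ is a solution of $\mathbf{y}'=\mathbf{A}(x)\mathbf{y}$ on $[a,b]$. (ii) (Nonhomogeneous case.) Let $(\mathbf{y}_j)_{j\ge 0}$ be a sequence of vector functions on $[a,b]$ satisfying $$\mathbf{y}_0'=\mathbf{H}(x)\mathbf{y}_0+\mathbf{F}(x),\qquad \mathbf{y}_j'=\mathbf{H}(x)\mathbf{y}_j+\mathbf{Z}(x)\mathbf{y}_{j-1}\quad (j=1,2,3,\ldots).$$ If the series $\sum_{j=0}^{\infty}\mathbf{y}_j(x)$ converges on $[a,b]$, then its sum $\mathbf{S}(x)=\sum_{j=0}^{\infty}\mathbf{y}_j(x)$ is a solution of $\mathbf{y}'=\mathbf{A}(x)\mathbf{y}+\mathbf{F}(x)$ on $[a,b]$.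
   Context: Here $[a,b]$ is a real interval and $n\ge 1$. $\mathbf{A}(x)=(a_{ij}(x))$ is an $n\times n$ matrix function, nonsingular, with entries continuous on $[a,b]$; $\mathbf{F}(x)=(f_1(x),\ldots,f_n(x))^T$ is a vector function with entries continuous on $[a,b]$. The matrix function $\mathbf{A}$ is split as $\mathbf{A}(x)=\mathbf{H}(x)+\mathbf{Z}(x)$, where $\mathbf{H}(x)$ and $\mathbf{Z}(x)$ are nonsingular $n\times n$ matrices, the entries of $\mathbf{Z}(x)$ are finite on $[a,b]$, and $\mathbf{H}(x)$ is either a matrix function on $[a,b]$ or a constant matrix. A prime denotes $d/dx$. The series $\sum_j \mathbf{y}_j$ is called the special series; convergence on $[a,b]$ means that the partial sums $\sum_{k=0}^{l}\mathbf{y}_k(x)$ converge, as $l\to\infty$, to a finite vector function $\mathbf{S}(x)$ on $[a,b]$.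
   Formalization: ''The entries of Z(x) are finite on [a,b]'' is taken to mean that they are bounded on [a,b]; with mere finiteness of each value the claim fails (n=1, A=1, Z=-1/x^2 for x>0, Z(0)=2 gives a discontinuous sum). *)

(* Defs.v *)
From mathcomp Require Import all_boot all_order all_algebra.
From mathcomp Require Import all_classical all_reals all_analysis.
Import Order.TTheory GRing.Theory Num.Theory.
Import numFieldNormedType.Exports.

Set Implicit Arguments.
Unset Strict Implicit.
Unset Printing Implicit Defensive.

Local Open Scope classical_set_scope.
Local Open Scope ring_scope.

(* Functions on [a, b] are total functions on R of which only the values on
   [a, b] are constrained. In particular, the derivative below only uses
   the values of f on [a, b]: it is two-sided in the interior and one-sided at
   the end points. It includes the existence of the derivative. *)
Definition has_derivative_on (R : realType) (V : normedModType R) (a b : R)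
    (f g : R -> V) : Prop :=
  forall x, x \in `[a, b] ->
    (t - x)^-1 *: (f t - f x) @[t --> within `[a, b] x^'] --> g x.

Definition continuous_entries (R : realType) (m n : nat) (a b : R)
    (M : R -> 'M[R]_(m, n)) : Prop :=
  forall i j, {within `[a, b], continuous (fun x => M x i j)}.

(* "The entries are finite on [a, b]" is read as boundedness: finiteness of
   each single value is vacuous for real-valued entries, and with it alone the
   sum of a pointwise convergent special series can be discontinuous. *)
Definition bounded_entries (R : realType) (m n : nat) (a b : R)
    (M : R -> 'M[R]_(m, n)) : Prop :=
  forall i j, [bounded M x i j | x in `[a, b]].

Definition nonsingular_on (R : realType) (n : nat) (a b : R)
    (M : R -> 'M[R]_n) : Prop :=
  forall x, x \in `[a, b] -> M x \in unitmx.

Definition series_converges_on (R : realType) (V : normedModType R) (a b : R)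
    (y : nat -> R -> V) (S : R -> V) : Prop :=
  forall x, x \in `[a, b] -> series (fun k => y k x) @ \oo --> S x.

(* Main.v *)
Require Import Defs.
From mathcomp Require Import all_boot all_order all_algebra.
From mathcomp Require Import ring lra.
From mathcomp Require Import all_classical all_reals all_analysis.
Import Order.TTheory GRing.Theory Num.Theory.
Import numFieldNormedType.Exports.

(** The special series is only assumed to converge pointwise. Everything rests on
upgrading this to uniform convergence, which is possible because the terms obey
a recursion with bounded coefficients.

Since Z is bounded and A is continuous on the compact interval, H = A - Z is
bounded as well; let P bound the three operator norms. All estimates use the
weight w(x) = exp (3 P (x - a)) and one form of Gronwall's inequality
([gronwall_expR]): if |f'| <= P |f| + P M w, then |f| <= B w as soon as
|f(a)| <= B and M < 2 B. A bound M w on y_(j-1) thus gives on y_j a bound with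
a constant about max (|y_j(a)|, M / 2); because y_j(a) tends to 0, the y_j tend
to 0 uniformly ([recursive_bound_uniform_cvg0]).

The partial sums s_k = y_0 + ... + y_k satisfy the telescoped equation
s_k' = A s_k + F - Z y_k. The difference of two partial sums therefore solves
the homogeneous equation up to the uniformly small error Z (y_m - y_k), and it
is small at a, so Gronwall's inequality makes (s_k) uniformly Cauchy. Then s_k'
converges uniformly to A S + F, and the classical theorem on limits of
derivatives ([has_derivative_on_lim]) concludes. The homogeneous case is F = 0.

No integral is used, since H need not be integrable: Gronwall's inequality and
the mean value inequality are both instances of a comparison principle
([has_derivative_on_ler_norm]) proved with a least upper bound. *)

Local Open Scope classical_set_scope.
Local Open Scope ring_scope.

Set Implicit Arguments.
Unset Strict Implicit.

(** * Derivatives relative to an interval *)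

(** The first-order expansion form avoids both the quotient and the exclusion of
the base point. *)
Lemma has_derivative_onP (R : realType) (V : normedModType R) (a b : R)
    (f g : R -> V) :
  has_derivative_on a b f g <->
  forall x, x \in `[a, b] -> forall e, 0 < e -> exists2 d, 0 < d &
    forall t, t \in `[a, b] -> `|t - x| < d ->
      `|f t - f x - (t - x) *: g x| <= e * `|t - x|.
Proof.
have quotE x t : t != x -> g x - (t - x)^-1 *: (f t - f x) =
    - ((t - x)^-1 *: (f t - f x - (t - x) *: g x)).
  move=> tx; rewrite [in RHS]scalerBr scalerA mulVf ?subr_eq0//.
  by rewrite scale1r opprB.
split=> [df x xab e e0|df x xab].
  have /cvgrPdist_le/(_ e e0)/nbhs_ballP[d d0 dP] := df x xab.
  exists d => // t tab tx.
  have [->|tNx] := eqVneq t x.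
    by rewrite !subrr scale0r subrr !normr0 mulr0.
  have := dP t; rewrite /= /ball/= distrC => /(_ tx tNx tab).
  rewrite quotE// normrN normrZ normfV mulrC ler_pdivrMr//.
  by rewrite normr_gt0 subr_eq0.
apply/cvgrPdist_le => e e0; have [d d0 dP] := df x xab e e0.
apply/nbhs_ballP; exists d => //= t; rewrite /ball/= distrC => tx tNx tab.
rewrite quotE// normrN normrZ normfV mulrC ler_pdivrMr ?normr_gt0 ?subr_eq0//.
exact: dP.
Qed.

Arguments has_derivative_onP {R V a b f g}.

Lemma is_derive_has_derivative_on (R : realType) (a b : R) (f g : R -> R) :
  (forall x : R, is_derive x 1 f (g x)) -> has_derivative_on a b f g.
Proof.
move=> df; apply/has_derivative_onP => x _ e e0.
have [dfx dfE] := df x.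
have /cvgrPdist_le/(_ e e0)/nbhs_ballP[d d0 dP] := dfx.
exists d => // t _ tx.
have [->|tNx] := eqVneq t x.
  by rewrite !subrr scale0r subrr !normr0 mulr0.
have := dP (t - x); rewrite /= /ball/= sub0r normrN subr_eq0 => /(_ tx tNx).
move: dfE; rewrite /derive => ->.
rewrite /GRing.scale/= mulr1 subrK => le_e.
rewrite -ler_pdivrMr ?normr_gt0 ?subr_eq0// -normfV -normrM -normrN.
apply: le_trans le_e; rewrite le_eqVlt; apply/orP; left; apply/eqP.
by congr `|_|; rewrite mulrC mulrBr mulKf ?subr_eq0// opprB.
Qed.

Lemma has_derivative_onB (R : realType) (V : normedModType R) (a b : R)
    (f1 f2 g1 g2 : R -> V) :
  has_derivative_on a b f1 g1 -> has_derivative_on a b f2 g2 ->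
  has_derivative_on a b (fun x => f1 x - f2 x) (fun x => g1 x - g2 x).
Proof.
move=> df1 df2 x xab; under eq_fun do rewrite opprD addrACA -opprD scalerBr.
exact: cvgB (df1 x xab) (df2 x xab).
Qed.

Lemma has_derivative_on_cst (R : realType) (V : normedModType R) (a b : R)
    (c : V) :
  has_derivative_on a b (fun=> c) (fun=> 0).
Proof.
by move=> x _; under eq_fun do rewrite subrr scaler0; exact: cvg_cst.
Qed.

Lemma has_derivative_onD (R : realType) (V : normedModType R) (a b : R)
    (f1 f2 g1 g2 : R -> V) :
  has_derivative_on a b f1 g1 -> has_derivative_on a b f2 g2 ->
  has_derivative_on a b (fun x => f1 x + f2 x) (fun x => g1 x + g2 x).
Proof.
move=> df1 df2 x xab; under eq_fun do rewrite opprD addrACA scalerDr.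
exact: cvgD (df1 x xab) (df2 x xab).
Qed.

Lemma eq_has_derivative_on (R : realType) (V : normedModType R) (a b : R)
    (f g h : R -> V) :
  (forall x, x \in `[a, b] -> g x = h x) ->
  has_derivative_on a b f g -> has_derivative_on a b f h.
Proof. by move=> gh df x xab; rewrite -gh//; exact: df. Qed.

Lemma has_derivative_onW (R : realType) (V : normedModType R) (a b c d : R)
    (f g : R -> V) :
  `[c, d] `<=` `[a, b] ->
  has_derivative_on a b f g -> has_derivative_on c d f g.
Proof.
move=> cdab /has_derivative_onP df; apply/has_derivative_onP => x xcd e e0.
have [k k0 kP] := df x (cdab x xcd) e e0.
by exists k => // t /cdab; exact: kP.
Qed.

Lemma has_derivative_on_continuous (R : realType) (V : normedModType R)
    (a b : R) (f g : R -> V) :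
  has_derivative_on a b f g -> forall x, x \in `[a, b] ->
  forall e, 0 < e -> exists2 d, 0 < d &
    forall t, t \in `[a, b] -> `|t - x| < d -> `|f t - f x| <= e.
Proof.
move=> /has_derivative_onP df x xab e e0; have [d d0 dP] := df x xab 1 ltr01.
have N0 : 0 < 1 + `|g x| by rewrite ltr_pwDl.
exists (Num.min d (e / (1 + `|g x|))) => [|t tab].
  by rewrite lt_min d0 divr_gt0.
rewrite lt_min => /andP[/(dP t tab) td te].
rewrite -(subrK ((t - x) *: g x) (f t - f x)).
apply: le_trans (ler_normD _ _) _; apply: le_trans (lerD td (lexx _)) _.
by rewrite normrZ [_ * `|g x|]mulrC -mulrDl mulrC -ler_pdivlMr// ltW.
Qed.

(** * Comparison principle and its consequences *)

(** Let s be the supremum of the x such that |f| <= g on [a, x]. By continuity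
|f(s)| <= g(s), so |f'(s)| < g'(s), and the first-order expansions at s
propagate |f| <= g beyond s unless s = b. The strict inequality is needed
only at points where |f| <= g holds, which is what allows the bound on f' to
depend on f. *)
Lemma has_derivative_on_ler_norm (R : realType) (V : normedModType R)
    (a b : R) (f f' : R -> V) (g g' : R -> R) :
  has_derivative_on a b f f' -> has_derivative_on a b g g' ->
  `|f a| <= g a ->
  (forall x, x \in `[a, b] -> `|f x| <= g x -> `|f' x| < g' x) ->
  forall x, x \in `[a, b] -> `|f x| <= g x.
Proof.
move=> df dg fga fg' z zab.
move: (zab); rewrite in_itv/= => /andP[az zb].
pose T := [set x | x \in `[a, b] /\ forall t, t \in `[a, x] -> `|f t| <= g t].
have Ta : T a.
  split; first by rewrite in_itv/= lexx (le_trans az).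
  by move=> t; rewrite in_itv/= -eq_le => /eqP <-.
have supT : has_sup T.
  by split; [exists a|exists b => x -[]; rewrite in_itv/= => /andP[]].
set s := sup T.
have as_ : a <= s by apply: ub_le_sup => //; case: supT.
have sb : s <= b.
  by apply: ge_sup; [exists a|move=> x -[]; rewrite in_itv/= => /andP[]].
have sab : s \in `[a, b] by rewrite in_itv/= as_.
have below t : a <= t -> t < s -> `|f t| <= g t.
  move=> at_ ts; have ts0 : 0 < s - t by rewrite subr_gt0.
  have [x [_ xT]] := sup_adherent ts0 supT.
  rewrite -/s opprB addrC subrK => /ltW tx.
  by apply: xT; rewrite in_itv/= at_.
have fgs : `|f s| <= g s.
  move: as_; rewrite le_eqVlt => /predU1P[<-//|as_].
  rewrite leNgt; apply/negP => gfs.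
  (* The steps from s to t cost e for f and for g: 2 e out of a gap of 3 e. *)
  pose e := (`|f s| - g s) / 3; have e0 : 0 < e by rewrite /e; lra.
  have [d1 d10 d1P] := has_derivative_on_continuous df sab e0.
  have [d2 d20 d2P] := has_derivative_on_continuous dg sab e0.
  pose d := Num.min d1 d2; have d0 : 0 < d by rewrite lt_min d10.
  have [t [at_ ts td]] : exists t, [/\ a <= t, t < s & s - t < d].
    exists (Num.max a (s - d / 2)); split; first by rewrite le_max lexx.
      by rewrite gt_max as_; lra.
    by rewrite ltrBlDr -ltrBlDl lt_max; apply/orP; right; lra.
  have tab : t \in `[a, b] by rewrite in_itv/= at_ (le_trans (ltW ts)).
  have tsd : `|t - s| < d by rewrite distrC gtr0_norm ?subr_gt0.
  move: (tsd); rewrite lt_min => /andP[/(d1P t tab) h1 /(d2P t tab)].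
  have := below t at_ ts; have := ler_norm (g t - g s).
  have := ler_distD (f t) (f s) 0; rewrite !subr0 distrC.
  move: h1; rewrite /e; lra.
have [sE|sNb] := eqVneq s b; last first.
  have {sNb} sb' : s < b by rewrite lt_neqAle sNb.
  have fgs' := fg' s sab fgs.
  pose e := (g' s - `|f' s|) / 2; have e0 : 0 < e by rewrite /e; lra.
  have [d1 d10 d1P] := has_derivative_onP.1 df s sab e e0.
  have [d2 d20 d2P] := has_derivative_onP.1 dg s sab e e0.
  (* e is half of the gap between g' and |f'|: each expansion error uses one
     half. *)
  pose d := Num.min (b - s) (Num.min d1 d2 / 2).
  have d0 : 0 < d by rewrite lt_min subr_gt0 sb' divr_gt0// lt_min d10.
  suff : T (s + d) by move=> /(ub_le_sup supT.2); rewrite -/s; lra.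
  have sdb : s + d <= b by rewrite -lerBrDl ge_min lexx.
  split; first by rewrite in_itv/= sdb andbT; lra.
  move=> t; rewrite in_itv/= => /andP[at_ tsd].
  have [ts|] := ltP t s; first exact: below.
  move=> st; have tab : t \in `[a, b] by rewrite in_itv/= at_ (le_trans tsd).
  have t0 : 0 <= t - s by rewrite subr_ge0.
  have tE : `|t - s| = t - s by rewrite ger0_norm.
  have : t - s < Num.min d1 d2.
    have : d <= Num.min d1 d2 / 2 by rewrite ge_min lexx orbT.
    have : 0 < Num.min d1 d2 by rewrite lt_min d10.
    lra.
  rewrite lt_min => /andP[td1 td2].
  have := d1P t tab; have := d2P t tab; rewrite tE => /(_ td2) h2 /(_ td1) h1.
  have ft : `|f t| <= `|f s| + (t - s) * `|f' s| + e * (t - s).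
    have := ler_normD (f t - f s - (t - s) *: f' s) (f s + (t - s) *: f' s).
    rewrite addrACA subrK addNr addr0.
    have := ler_normD (f s) ((t - s) *: f' s); rewrite normrZ tE; lra.
  move: h2; rewrite ler_norml => /andP[+ _]; rewrite /GRing.scale/=.
  by move: ft; rewrite /e; lra.
by move: zb; rewrite -sE le_eqVlt => /predU1P[->//|]; exact: below.
Qed.

(** Mean value inequality: f - f(x) is compared on [x, t] with the linear
function of slope K + e, the e > 0 making the inequality of slopes strict. *)
Lemma has_derivative_on_ler_dist (R : realType) (V : normedModType R)
    (a b K : R) (f f' : R -> V) :
  has_derivative_on a b f f' -> (forall x, x \in `[a, b] -> `|f' x| <= K) ->
  {in `[a, b] &, forall x t, `|f t - f x| <= K * `|t - x|}.
Proof.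
move=> df f'K x t; wlog : x t / x <= t => [hwlog xab tab|].
  have /orP[xt|tx] := le_total x t; first exact: hwlog.
  by rewrite distrC [`|t - x|]distrC; exact: hwlog.
rewrite le_eqVlt => /predU1P[->|xt] xab tab.
  by rewrite !subrr !normr0 mulr0.
have xt0 : 0 < t - x by rewrite subr_gt0.
rewrite (gtr0_norm xt0) -ler_pdivrMr//; apply/ler_addgt0Pr => e e0.
have xtab : `[x, t] `<=` `[a, b].
  move=> u; move: xab tab; rewrite !in_itv/= => /andP[ax xb] /andP[at_ tb].
  rewrite /= !in_itv/= => /andP[xu ut].
  by rewrite (le_trans ax)// (le_trans ut).
have dfx := has_derivative_onB (has_derivative_onW xtab df)
  (@has_derivative_on_cst _ _ x t (f x)).
have dl : has_derivative_on x t (fun u => (K + e) * (u - x)) (fun=> K + e).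
  apply: is_derive_has_derivative_on => u.
  by apply: is_derive_eq; rewrite /GRing.scale/= subr0 mulr1.
rewrite ler_pdivrMr//.
apply: (has_derivative_on_ler_norm dfx dl).
- by rewrite !subrr normr0 mulr0.
- by move=> u /xtab uab _; rewrite subr0 (le_lt_trans (f'K u uab))// ltrDl.
- by rewrite in_itv/= lexx ltW.
Qed.

(** By the mean value inequality, the increments of s_k - s_N are at most e / 2
times those of the variable, uniformly in k >= N; the bound passes to the limit
k -> oo, which compares S with the single differentiable function s_N. *)
Lemma has_derivative_on_lim (R : realType) (V : normedModType R) (a b : R)
    (s g : nat -> R -> V) (S G : R -> V) :
  (forall k, has_derivative_on a b (s k) (g k)) ->
  (forall x, x \in `[a, b] -> s k x @[k --> \oo] --> S x) ->
  (forall e, 0 < e -> exists N, forall k, (N <= k)%N ->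
     forall x, x \in `[a, b] -> `|g k x - G x| <= e) ->
  has_derivative_on a b S G.
Proof.
move=> ds sS gG; apply/has_derivative_onP => x xab e e0.
have e40 : 0 < e / 4 by rewrite divr_gt0.
have [N NP] := gG _ e40.
have [d d0 dP] := has_derivative_onP.1 (ds N) x xab _ e40.
exists d => // t tab tx.
have increment : `|(S t - s N t) - (S x - s N x)| <= e / 2 * `|t - x|.
  apply: (@cvgr_to_le _ \oo _ _
    (fun k => `|(s k t - s N t) - (s k x - s N x)|)).
    apply: cvg_norm; apply: cvgB.
      by apply: cvgB; [exact: sS|exact: cvg_cst].
    by apply: cvgB; [exact: sS|exact: cvg_cst].
  near=> k; have Nk : (N <= k)%N by near: k; exact: nbhs_infty_ge.
  apply: (has_derivative_on_ler_dist (has_derivative_onB (ds k) (ds N))) => //.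
  move=> u uab; have := NP k Nk u uab; have := NP N (leqnn N) u uab.
  by have := ler_distD (G u) (g k u) (g N u); rewrite [`|G u - _|]distrC; lra.
have -> : S t - S x - (t - x) *: G x = ((S t - s N t) - (S x - s N x)) +
    ((s N t - s N x - (t - x) *: g N x) + (t - x) *: (g N x - G x)).
  rewrite scalerBr [in RHS](addrA (s N t - _ - _)) subrK.
  rewrite [in RHS]addrA; congr (_ - _).
  by rewrite addrACA subrK -opprD subrK.
apply: le_trans (ler_normD _ _) _.
apply: le_trans (lerD increment (ler_normD _ _)) _.
have := dP t tab tx; rewrite normrZ.
have := ler_wpM2l (normr_ge0 (t - x)) (NP N (leqnn N) x xab).
lra.
Unshelve. all: by end_near. Qed.

(** Comparison of f with B w, where w(x) = exp (3 P (x - a)): wherever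
|f| <= B w, the hypothesis gives |f'| <= P (B + M) w < 3 P B w = (B w)'. *)
Lemma gronwall_expR (R : realType) (V : normedModType R) (a b P M B : R)
    (f f' : R -> V) :
  0 < P -> has_derivative_on a b f f' ->
  (forall x, x \in `[a, b] ->
     `|f' x| <= P * `|f x| + P * M * expR (3 * P * (x - a))) ->
  `|f a| <= B -> M < 2 * B ->
  forall x, x \in `[a, b] -> `|f x| <= B * expR (3 * P * (x - a)).
Proof.
move=> P0 df f'P faB MB.
have dw : has_derivative_on a b (fun x => B * expR (3 * P * (x - a)))
    (fun x => 3 * P * B * expR (3 * P * (x - a))).
  apply: is_derive_has_derivative_on => x.
  by apply: is_derive_eq; rewrite /GRing.scale/=; ring.
apply: (has_derivative_on_ler_norm df dw).
  by rewrite subrr mulr0 expR0 mulr1.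
move=> x xab fx; apply: le_lt_trans (f'P x xab) _.
set w := expR _ in fx *; have w0 : 0 < w := expR_gt0 _.
apply: (@le_lt_trans _ _ (P * (B * w) + P * M * w)).
  by rewrite lerD2r ler_pM2l.
have : 0 < P * w * (2 * B - M) by rewrite !mulr_gt0// subr_gt0.
lra.
Qed.

(** * Bounds on matrix functions *)

Lemma ler_mx_entry_norm (R : realType) (m n : nat) (M : 'M[R]_(m, n)) i j :
  `|M i j| <= `|M|.
Proof.
rewrite [`|M|]mx_normrE.
exact: (le_bigmax _ (fun ij => `|M ij.1 ij.2|) (i, j)).
Qed.

Lemma ler_mx_norm (R : realType) (m n : nat) (M : 'M[R]_(m, n)) (C : R) :
  0 <= C -> (forall i j, `|M i j| <= C) -> `|M| <= C.
Proof.
move=> C0 MC; rewrite [`|M|]mx_normrE.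
by apply: bigmax_le => // -[i j] _; exact: MC.
Qed.

Lemma ler_norm_mulmx (R : realType) (m n p : nat) (M : 'M[R]_(m, n))
    (N : 'M[R]_(n, p)) :
  `|M *m N| <= n%:R * `|M| * `|N|.
Proof.
apply: ler_mx_norm => [|i j]; first by rewrite !mulr_ge0.
rewrite mxE; apply: le_trans (ler_norm_sum _ _ _) _.
apply: (@le_trans _ _ (\sum_(k < n) `|M| * `|N|)).
  by apply: ler_sum => k _; rewrite normrM ler_pM// ler_mx_entry_norm.
by rewrite sumr_const card_ord -mulrA [leRHS]mulr_natl.
Qed.

Lemma bounded_entries_norm (R : realType) (m n : nat) (a b : R)
    (M : R -> 'M[R]_(m, n)) :
  bounded_entries a b M ->
  exists2 C, 0 < C & forall x, x \in `[a, b] -> `|M x| <= C.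
Proof.
move=> bM.
have {}bM (ij : 'I_m * 'I_n) :
    exists C, forall x, x \in `[a, b] -> `|M x ij.1 ij.2| <= C.
  have [C [_ CP]] := bM ij.1 ij.2; exists (C + 1) => x xab.
  by apply: (CP (C + 1)) => //; rewrite ltrDl.
have [C CP] := choice bM.
exists (1 + \sum_ij `|C ij|); first by rewrite ltr_pwDl// sumr_ge0.
move=> x xab; apply: ler_mx_norm => [|i j].
  by rewrite addr_ge0// sumr_ge0.
apply: le_trans (CP (i, j) x xab) _; apply: le_trans (ler_norm _) _.
by rewrite (bigD1 (i, j))//= addrCA lerDl addr_ge0// sumr_ge0.
Qed.

Lemma continuous_bounded_entries (R : realType) (m n : nat) (a b : R)
    (M : R -> 'M[R]_(m, n)) :
  continuous_entries a b M -> bounded_entries a b M.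
Proof.
move=> cM i j.
have := compact_bounded (continuous_compact (cM i j) (@segment_compact _ a b)).
move=> [C [Cr CP]]; exists C; split => // K CK x xab.
by apply: (CP K CK); exists x.
Qed.


(** * The special series *)

(** Iterating Gronwall's inequality, the factor 1 / 2 gained at each step makes
the contribution of the earlier terms decay geometrically; what remains is of
the size of the initial values y_k(a), which tend to 0. *)
Lemma recursive_bound_uniform_cvg0 (R : realType) (V : normedModType R)
    (a b P C : R) (y y' : nat -> R -> V) :
  0 < P -> 0 <= C ->
  (forall k, has_derivative_on a b (y k) (y' k)) ->
  (forall x, x \in `[a, b] -> `|y' 0%N x| <= P * `|y 0%N x| + C) ->
  (forall k x, x \in `[a, b] ->
     `|y' k.+1 x| <= P * `|y k.+1 x| + P * `|y k x|) ->
  y k a @[k --> \oo] --> (0 : V) ->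
  forall e, 0 < e -> exists N, forall k, (N <= k)%N ->
    forall x, x \in `[a, b] -> `|y k x| <= e * expR (3 * P * (x - a)).
Proof.
move=> P0 C0 dy y'0 y'S ya e e0; pose w x := expR (3 * P * (x - a)).
have w1 x : x \in `[a, b] -> 1 <= w x.
  rewrite in_itv/= => /andP[ax _].
  by rewrite -expR0 ler_expR !mulr_ge0// ?subr_ge0// ltW.
have step k M B : (forall x, x \in `[a, b] -> `|y k x| <= M * w x) ->
    `|y k.+1 a| <= B -> M < 2 * B ->
    forall x, x \in `[a, b] -> `|y k.+1 x| <= B * w x.
  move=> ykM; apply: (gronwall_expR P0 (dy k.+1)) => x xab.
  apply: le_trans (y'S k x xab) _; rewrite lerD2l -mulrA ler_pM2l//.
  exact: ykM.
have bounded k : exists M, forall x, x \in `[a, b] -> `|y k x| <= M * w x.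
  elim: k => [|k [M yM]].
    exists (`|y 0%N a| + C / P + 1).
    apply: (@gronwall_expR _ _ _ _ _ (C / P) _ _ _ P0 (dy 0%N)).
    - move=> x xab; apply: le_trans (y'0 x xab) _.
      by rewrite lerD2l [P * _]mulrC divfK ?gt_eqF// ler_peMr// w1.
    - by rewrite -addrA lerDl addr_ge0// divr_ge0// ltW.
    - by have := divr_ge0 C0 (ltW P0); have := normr_ge0 (y 0%N a); lra.
  exists (`|y k.+1 a| + `|M| + 1); apply: (step k M) => //.
    by rewrite -addrA lerDl addr_ge0.
  by have := ler_norm M; have := normr_ge0 M; have := normr_ge0 (y k.+1 a); lra.
have e20 : 0 < e / 2 by rewrite divr_gt0.
have [N0 _ yaN0] := (cvgrPdist_le _ _).1 ya _ e20.
have {}yaN0 k : (N0 <= k)%N -> `|y k a| <= e / 2.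
  by move=> /yaN0/=; rewrite sub0r normrN.
have [M yM] := bounded N0.
(* The constants B_i below satisfy 2 B_(i+1) = B_i + e / 2, whence the strict
   inequality required by Gronwall's inequality. *)
have decay i : forall x, x \in `[a, b] ->
    `|y (i + N0)%N x| <= (e / 2 + `|M| * 2^-1 ^+ i) * w x.
  elim: i => [x xab|i IH].
    apply: le_trans (yM x xab) _.
    by rewrite ler_pM2r ?expR_gt0// expr0 mulr1 ler_wpDl ?ler_norm// ltW.
  rewrite addSn; apply: (step _ _ _ IH).
    apply: le_trans (yaN0 _ _) _; first by rewrite -addSn leq_addl.
    by rewrite lerDl mulr_ge0// exprn_ge0// invr_ge0.
  by rewrite exprS; lra.
have half0 : `|M| * 2^-1 ^+ i @[i --> \oo] --> 0.
  rewrite -[X in _ --> X](mulr0 `|M|); apply: cvgM; first exact: cvg_cst.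
  by apply: cvg_expr; rewrite ger0_norm ?invr_ge0//; lra.
have [N1 _ N1P] := (cvgrPdist_le _ _).1 half0 _ e20.
exists (N1 + N0)%N => k; rewrite addnC => Nk x xab.
have N0k : (N0 <= k)%N := leq_trans (leq_addr _ _) Nk.
rewrite -(subnK N0k); apply: le_trans (decay _ x xab) _.
rewrite ler_pM2r ?expR_gt0//.
have /N1P/= : (N1 <= k - N0)%N by rewrite leq_subRL.
rewrite sub0r normrN ger0_norm; first lra.
by rewrite mulr_ge0// exprn_ge0// invr_ge0.
Qed.

(** The series of the y_j converges uniformly, and so do the derivatives of its
partial sums, by the telescoped equation s_k' = A s_k + F - Z y_k. *)
Lemma special_series_solution (R : realType) (n : nat) (a b P C : R)
    (A H Z : R -> 'M[R]_n) (F : R -> 'cV[R]_n)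
    (y : nat -> R -> 'cV[R]_n) (S : R -> 'cV[R]_n) :
  a <= b -> 0 < P -> 0 <= C ->
  (forall x, x \in `[a, b] -> A x = H x + Z x) ->
  (forall x (v : 'cV[R]_n), x \in `[a, b] -> `|A x *m v| <= P * `|v|) ->
  (forall x (v : 'cV[R]_n), x \in `[a, b] -> `|H x *m v| <= P * `|v|) ->
  (forall x (v : 'cV[R]_n), x \in `[a, b] -> `|Z x *m v| <= P * `|v|) ->
  (forall x, x \in `[a, b] -> `|F x| <= C) ->
  has_derivative_on a b (y 0%N) (fun x => H x *m y 0%N x + F x) ->
  (forall j : nat, (1 <= j)%N ->
     has_derivative_on a b (y j) (fun x => H x *m y j x + Z x *m y j.-1 x)) ->
  series_converges_on a b y S ->
  has_derivative_on a b S (fun x => A x *m S x + F x).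
Proof.
move=> ab P0 C0 AHZ AP HP ZP FC dy0 dyS yS.
pose w x := expR (3 * P * (x - a)).
have aab : a \in `[a, b] by rewrite in_itv/= lexx.
(* [series u k] has k terms, so the shift makes [s k] end with [y k]. *)
pose s k x := series (fun i => y i x) k.+1.
have s_cvg x : x \in `[a, b] -> s k x @[k --> \oo] --> S x.
  by move=> /yS; rewrite -cvg_shiftS.
have ds k : has_derivative_on a b (s k)
    (fun x => A x *m s k x + F x - Z x *m y k x).
  elim: k => [|k IH].
    have -> : s 0%N = y 0%N by apply/funext => x; rewrite /s /series/= big_nat1.
    apply: eq_has_derivative_on dy0 => x xab.
    by rewrite AHZ// mulmxDl addrAC addrK.
  have -> : s k.+1 = fun x => s k x + y k.+1 x.
    by apply/funext => x; rewrite /s /series/= big_nat_recr.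
  apply: eq_has_derivative_on (has_derivative_onD IH (dyS k.+1 isT)) => x xab.
  have AyE : A x *m y k.+1 x = H x *m y k.+1 x + Z x *m y k.+1 x.
    by rewrite AHZ// mulmxDl.
  rewrite /= mulmxDr AyE.
  rewrite [H x *m y k.+1 x + Z x *m y k x]addrC addrA subrK.
  by rewrite [in RHS]addrA [RHS]addrAC addrK addrAC.
have y_small : forall e, 0 < e -> exists N, forall k, (N <= k)%N ->
    forall x, x \in `[a, b] -> `|y k x| <= e * w x.
  pose y' k x := H x *m y k x + if k is j.+1 then Z x *m y j x else F x.
  apply: (@recursive_bound_uniform_cvg0 _ _ a b P C y y') => //.
  - by case=> [|k]; [exact: dy0|exact: (dyS k.+1)].
  - by move=> x xab; apply: le_trans (ler_normD _ _) _; rewrite lerD ?HP ?FC.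
  - by move=> k x xab; apply: le_trans (ler_normD _ _) _; rewrite lerD ?HP ?ZP.
  - by apply: cvg_series_cvg_0; apply/cvg_ex; exists (S a); exact: yS.
have s_unif e : 0 < e -> exists N, forall k, (N <= k)%N ->
    forall x, x \in `[a, b] -> `|y k x| <= e * w x /\ `|s k x - S x| <= e * w x.
  move=> e0; have e30 : 0 < e / 3 by rewrite divr_gt0.
  (* The perturbation Z (y_m - y_k) has size at most 2 P (e / 3) w, and
     2 (e / 3) < 2 e leaves room to conclude with the constant e. *)
  have [N1 N1P] := y_small _ e30.
  have [N2 _ N2P] := (cvgrPdist_le _ _).1 (s_cvg a aab) _ e30.
  exists (maxn N1 N2) => k; rewrite geq_max => /andP[N1k N2k] x xab.
  split.
    apply: le_trans (N1P k N1k x xab) _.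
    by rewrite ler_pM2r ?expR_gt0//; lra.
  rewrite distrC; apply: (@cvgr_to_le _ \oo _ _ (fun m => `|s m x - s k x|)).
    by apply: cvg_norm; apply: cvgB; [exact: s_cvg|exact: cvg_cst].
  near=> m; have N1m : (N1 <= m)%N by near: m; exact: nbhs_infty_ge.
  have N2m : (N2 <= m)%N by near: m; exact: nbhs_infty_ge.
  move: x xab; apply: (@gronwall_expR _ _ _ _ _ (2 * (e / 3)) _ _ _ P0
    (has_derivative_onB (ds m) (ds k))).
  - move=> x xab.
    have -> : (A x *m s m x + F x - Z x *m y m x) -
        (A x *m s k x + F x - Z x *m y k x) =
        A x *m (s m x - s k x) - Z x *m (y m x - y k x).
      rewrite !mulmxBr opprD addrACA -opprD; congr (_ - _).
      by rewrite opprD addrACA subrr addr0.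
    apply: le_trans (ler_normB _ _) _; apply: lerD; first exact: AP.
    apply: le_trans (ZP _ _ xab) _; rewrite -mulrA ler_pM2l//.
    have := N1P m N1m x xab; have := N1P k N1k x xab.
    by have := ler_normB (y m x) (y k x); rewrite /w; lra.
  - have := N2P m N2m; have := N2P k N2k => /=.
    have := ler_distD (S a) (s m a) (s k a).
    by rewrite [`|s m a - S a|]distrC; lra.
  - lra.
apply: has_derivative_on_lim ds s_cvg _ => e e0.
have d0 : 0 < e / (2 * P * w b) by rewrite divr_gt0// !mulr_gt0// expR_gt0.
have [N NP] := s_unif _ d0; exists N => k Nk x xab.
have [yk sk] := NP k Nk x xab.
have -> : A x *m s k x + F x - Z x *m y k x - (A x *m S x + F x) =
    A x *m (s k x - S x) - Z x *m y k x.
  rewrite mulmxBr addrAC; congr (_ - _).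
  by rewrite opprD addrACA subrr addr0.
have wxb : w x <= w b.
  move: xab; rewrite in_itv/= => /andP[_ xb].
  by rewrite ler_expR ler_pM2l ?mulr_gt0// lerD2r.
set d := e / _ in d0 yk sk.
have -> : e = P * (d * w b) + P * (d * w b).
  by rewrite /d; field; rewrite !gt_eqF// expR_gt0.
have dw : d * w x <= d * w b by rewrite ler_pM2l.
apply: le_trans (ler_normB _ _) _; apply: lerD.
  by apply: le_trans (AP _ _ xab) _; rewrite ler_pM2l// (le_trans sk).
by apply: le_trans (ZP _ _ xab) _; rewrite ler_pM2l// (le_trans yk).
Unshelve. all: by end_near. Qed.

Unset Implicit Arguments.
Set Strict Implicit.

Theorem mainTheorem1 (R : realType) (n : nat) (hn : (1 <= n)%N)
    (a b : R) (hab : a < b)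
    (A H Z : R -> 'M[R]_n) (F : R -> 'cV[R]_n)
    (hA : nonsingular_on a b A) (cA : continuous_entries a b A)
    (cF : continuous_entries a b F)
    (hAHZ : forall x, x \in `[a, b] -> A x = H x + Z x)
    (hH : nonsingular_on a b H) (hZ : nonsingular_on a b Z)
    (bZ : bounded_entries a b Z) :
  (forall (y : nat -> R -> 'cV[R]_n) (S : R -> 'cV[R]_n),
      has_derivative_on a b (y 0%N) (fun x => H x *m y 0%N x) ->
      (forall j : nat, (1 <= j)%N ->
         has_derivative_on a b (y j)
           (fun x => H x *m y j x + Z x *m y j.-1 x)) ->
      series_converges_on a b y S ->
      has_derivative_on a b S (fun x => A x *m S x))
  /\
  (forall (y : nat -> R -> 'cV[R]_n) (S : R -> 'cV[R]_n),
      has_derivative_on a b (y 0%N) (fun x => H x *m y 0%N x + F x) ->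
      (forall j : nat, (1 <= j)%N ->
         has_derivative_on a b (y j)
           (fun x => H x *m y j x + Z x *m y j.-1 x)) ->
      series_converges_on a b y S ->
      has_derivative_on a b S (fun x => A x *m S x + F x)).
Proof.
have [KA KA0 AK] := bounded_entries_norm (continuous_bounded_entries cA).
have [KZ KZ0 ZK] := bounded_entries_norm bZ.
have [C C0 FC] := bounded_entries_norm (continuous_bounded_entries cF).
have n0 : 0 < n%:R :> R by rewrite ltr0n.
pose P := n%:R * (KA + KZ).
have P0 : 0 < P by rewrite mulr_gt0// addr_gt0.
have normP (M : 'M[R]_n) (v : 'cV[R]_n) :
    `|M| <= KA + KZ -> `|M *m v| <= P * `|v|.
  move=> MK; apply: le_trans (ler_norm_mulmx _ _) _.
  by rewrite ler_wpM2r// ler_pM2l.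
have AP x (v : 'cV[R]_n) : x \in `[a, b] -> `|A x *m v| <= P * `|v|.
  by move=> xab; apply: normP; rewrite ler_wpDr ?AK// ltW.
have ZP x (v : 'cV[R]_n) : x \in `[a, b] -> `|Z x *m v| <= P * `|v|.
  by move=> xab; apply: normP; rewrite ler_wpDl ?ZK// ltW.
have HP x (v : 'cV[R]_n) : x \in `[a, b] -> `|H x *m v| <= P * `|v|.
  move=> xab; apply: normP; rewrite -[H x](addrK (Z x)) -hAHZ//.
  by apply: le_trans (ler_normB _ _) _; rewrite lerD ?AK ?ZK.
split=> y S dy0 dyS yS; last first.
  exact: special_series_solution (ltW hab) P0 (ltW C0) hAHZ AP HP ZP FC dy0
    dyS yS.
have F0 x : x \in `[a, b] -> `|(fun=> 0 : 'cV[R]_n) x| <= C.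
  by move=> _; rewrite normr0 ltW.
apply: eq_has_derivative_on
  (special_series_solution (ltW hab) P0 (ltW C0) hAHZ AP HP ZP F0 _ dyS yS).
  by move=> x _; rewrite addr0.
by apply: eq_has_derivative_on dy0 => x _; rewrite addr0.
Qed.
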